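(* Let $1\le k<N/2$ and $l\ge 1$. Consider the problem of identifying an unknown $x\in\{0,1\}^N$ with $wt(x)=k$ using the balance oracle, under the restriction that every query string (in every superposition) places at least $l$ coins on the pans. Then every quantum algorithm that identifies $x$ with bounded error needs $\Omega((lk/N)^{1/4})$ queries. In particular, if there is a constant $c$ such that at least $N/c$ coins must be placed on the pans in every query, then $\Omega(k^{1/4})$ queries are necessary.
   Context: Counterfeit coin model: $x\in\{0,1\}^N$, $x_i=1$ meaning coin $i$ is false; $k=wt(x)$ (Hamming weight) is known and $k<N/2$. For $l'\le\lfloor N/2\rfloor$, $Q_{l'}$ is the set of $q\in\{0,1,-1\}^N$ with exactly $l'$ entries $1$ and $l'$ entries $-1$ ($1$: left pan, $-1$: right pan, $0$: not weighed). For such $q$, $\chi(x;q)=0$ if $\sum_iq_ix_i=0$ (balanced) and $1$ otherwise (tilted). The balance oracle is the unitary $|q\rangle\mapsto(-1)^{\chi(x;q)}|q\rangle$ (equivalently $|q,a\rangle\mapsto|q,a\oplus\chi(x;q)\rangle$). The restriction ''at least $l$ coins placed on the pans'' means only query strings $q$ with at least $l$ nonzero entries may be queried. Bounded error: the output equals $x$ with probability at least a fixed constant $>1/2$ (e.g. $2/3$) for every admissible $x$. *)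

(* Defs.v *)
From HB Require Import structures.
From mathcomp Require Import all_boot all_order all_algebra.
From mathcomp Require Import reals.
From mathcomp Require Import complex.
Set Implicit Arguments. Unset Strict Implicit. Unset Printing Implicit Defensive.
Import Order.TTheory GRing.Theory Num.Theory.
Local Open Scope ring_scope.

(* x : {0,1}^N ; x i = true means coin i is false (counterfeit). *)
Definition coins (N : nat) := {ffun 'I_N -> bool}.

Definition wt (N : nat) (x : coins N) : nat := #|[set i | x i]|.

(* A string in {0,1,-1}^N: None = 0 (not weighed), Some true = 1 (left pan),
   Some false = -1 (right pan). *)
Definition qstring (N : nat) := {ffun 'I_N -> option bool}.

Definition qentry (o : option bool) : int :=
  match o with None => 0 | Some true => 1 | Some false => -1 end.

Definition nleft  (N : nat) (q : qstring N) : nat := #|[set i | q i == Some true]|.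
Definition nright (N : nat) (q : qstring N) : nat := #|[set i | q i == Some false]|.
Definition nweighed (N : nat) (q : qstring N) : nat := #|[set i | q i != None]|.

(* q belongs to Q_{l'} for some l' (equally many 1's and -1's; then automatically
   l' <= floor(N/2)), and at least l coins are placed on the pans. *)
Definition admissible (N l : nat) (q : qstring N) : bool :=
  (nleft q == nright q) && (l <= nweighed q)%N.

Definition chi (N : nat) (x : coins N) (q : qstring N) : bool :=
  (\sum_(i < N) qentry (q i) * (x i)%:Z)%R != 0.

Definition AQ (N l : nat) := {q : qstring N | admissible l q}.

(* Basis of the Hilbert space: query register (admissible strings only),
   answer bit, and an arbitrary finite workspace W. *)
Definition basis (N l : nat) (W : finType) := (AQ N l * bool * W)%type.

Definition state (R : realType) (I : finType) := I -> R[i].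
Definition op (R : realType) (I : finType) := I -> I -> R[i].

Definition apply (R : realType) (I : finType) (U : op R I) (v : state R I) : state R I :=
  fun i => \sum_(j : I) U i j * v j.

(* U^dagger U = 1 (equivalently, U is unitary, in finite dimension) *)
Definition unitary (R : realType) (I : finType) (U : op R I) : Prop :=
  forall i j : I, \sum_(k : I) (U k i)^* * U k j = (i == j)%:R.

(* Balance oracle |q,a,w> |-> |q, a xor chi(x;q), w> *)
Definition oracle (R : realType) (N l : nat) (W : finType) (x : coins N)
    (v : state R (basis N l W)) : state R (basis N l W) :=
  fun b => let: (q, a, w) := b in v (q, xorb a (chi x (val q)), w).

(* A T-query algorithm: initial basis state, unitaries U_0..U_T (only indices
   <= T matter), and classical post-processing of the final computational-basis
   measurement outcome. *)
Record algorithm (R : realType) (N l : nat) (W : finType) := Algorithm {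
  alg_init : basis N l W;
  alg_U : nat -> op R (basis N l W);
  alg_out : basis N l W -> coins N
}.

Fixpoint run (R : realType) (N l : nat) (W : finType) (A : algorithm R N l W)
    (x : coins N) (t : nat) : state R (basis N l W) :=
  match t with
  | 0 => apply (alg_U A 0) (fun b => (b == alg_init A)%:R)
  | t'.+1 => apply (alg_U A t) (oracle x (run A x t'))
  end.

Definition sqnorm (R : realType) (z : R[i]) : R :=
  let: Complex a b := z in a ^+ 2 + b ^+ 2.

Definition success_prob (R : realType) (N l : nat) (W : finType)
    (A : algorithm R N l W) (T : nat) (x : coins N) : R :=
  \sum_(b : basis N l W | alg_out A b == x) sqnorm (run A x T b).

Definition identifies (R : realType) (N l k T : nat) (W : finType)
    (A : algorithm R N l W) (p : R) : Prop :=
  (forall t, (t <= T)%N -> unitary (alg_U A t)) /\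
  (forall x : coins N, wt x = k -> p <= success_prob A T x).

(* Main.v *)
From HB Require Import structures.
From mathcomp Require Import all_boot all_order all_algebra.
From mathcomp Require Import reals.
From mathcomp Require Import complex.
From mathcomp Require Import zify ring lra.
Require Import Defs.

(** Run the algorithm with an oracle that always answers "tilted".  This run does not depend on the hidden [x], so on average over [x] it succeeds with probability at most [1 / 'C(N, k)]; the true run differs from it only through the amplitude sitting on queries that balance [x].  For a fixed query with [L] coins on each pan, a uniform [x] of weight [k] is balanced with probability at most [O(sqrt (N / (L k)))], and a hybrid argument yields [T ^ 2 * sqrt (N / (l k)) = Omega(1)].

    For the probability estimate, pair each left coin with a right coin.  Given the number [m] of pairs with exactly one false coin, balance means that a fair [m]-step walk returns to [0], which has squared probability at most [1 / (m + 1)], and the mean of [1 / (m + 1)] is bounded by adding one pair.  In generating functions, [(X + Y)(1 + X Y) = Y (1 + X ^ 2) + X (1 + Y ^ 2)]. *)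

Set Implicit Arguments. Unset Strict Implicit. Unset Printing Implicit Defensive.
Import Order.TTheory GRing.Theory Num.Theory.
Local Open Scope ring_scope.

(** * Central binomial coefficients and generating functions for pairs of coins *)

(** Counts the [m]-step walks with steps [+1] and [-1] that return to 0. *)
Definition central_bin (m : nat) : nat := if odd m then 0 else 'C(m, m./2).

(** By induction on [n = m / 2]: the ratio of consecutive central coefficients is
    [2 (2n + 1) / (n + 1)], and [(2n + 1) (2n + 3) <= (2n + 2) ^ 2]. *)
Lemma central_bin_sqr_le (m : nat) : (central_bin m ^ 2 * m.+1 <= 4 ^ m)%N.
Proof.
rewrite /central_bin; case: ifP => [_|/negbT/even_halfK <-]; first by [].
rewrite doubleK; elim: (m./2) => [|n IHn]; first by [].
have rec : ('C(n.+1.*2, n.+1) * n.+1 = 'C(n.*2, n) * (2 * (n.*2.+1)))%N.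
  have h1 := mul_bin_diag n.+1.*2 n.
  have h2 := mul_bin_down n.*2.+1 n.
  rewrite doubleS /= in h1 h2 *.
  nia.
have : ('C(n.+1.*2, n.+1) ^ 2 * (n.+1.*2.+1) * n.+1 ^ 2 * n.*2.+1
   <= 16 * ('C(n.*2, n) ^ 2 * n.*2.+1) * n.+1 ^ 2 * n.*2.+1)%N.
  have -> : ('C(n.+1.*2, n.+1) ^ 2 * (n.+1.*2.+1) * n.+1 ^ 2 * n.*2.+1 =
     ('C(n.+1.*2, n.+1) * n.+1) ^ 2 * n.+1.*2.+1 * n.*2.+1)%N by ring.
  rewrite rec; move: ('C(n.*2, n)) => c; nia.
rewrite !leq_pmul2r ?expn_gt0 //.
move/leq_trans; apply.
by rewrite doubleS !expnS; lia.
Qed.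

Lemma coef_expr_1DXn2 (A : comNzSemiRingType) (m : nat) :
  ((1 + 'X^2 : {poly A}) ^+ m)`_m = (central_bin m)%:R.
Proof.
rewrite exprDn coef_sum.
under eq_bigr => i _ do rewrite expr1n mul1r -exprM coefMn coefXn.
rewrite /central_bin; case: ifP => om.
  rewrite big1 // => i _.
  case: eqP => [mE|]; last by rewrite mul0rn.
  by move: (congr1 odd mE); rewrite om mul2n odd_double.
have hm : (m./2 < m.+1)%N by lia.
rewrite (bigD1 (Ordinal hm)) //= big1 ?addr0.
  by have -> : (m == 2 * m./2)%N by lia.
move=> i ne; case: eqP => [mE|]; last by rewrite mul0rn.
case/eqP: ne; apply: val_inj => /=; lia.
Qed.

Lemma coef_expr_1DX (A : comNzSemiRingType) (n k : nat) :
  ((1 + 'X : {poly A}) ^+ n)`_k = 'C(n, k)%:R.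
Proof.
rewrite exprDn coef_sum.
under eq_bigr => i _ do rewrite expr1n mul1r coefMn coefXn.
case: (leqP k n) => kn.
  rewrite (bigD1 (Ordinal (kn : (k < n.+1)%N))) //= big1 ?addr0 ?eqxx //.
  move=> i ne; case: eqP => [mE|]; last by rewrite mul0rn.
  by case/eqP: ne; apply: val_inj.
rewrite bin_small // big1 // => i _.
case: eqP => [kE|]; last by rewrite mul0rn.
by move: kn; rewrite kE ltnNge -ltnS ltn_ord.
Qed.

(* The number of ways to place [k] false coins on [L] pairs and [r] single coins, given which [m] pairs contain exactly one false coin and which coin that is. *)
Definition mixed_coef (L r k m : nat) : nat :=
  (((1 + 'X^2) ^+ (L - m) * 'X^m * (1 + 'X) ^+ r : {poly nat})`_k)%R.

(** Each pair contributes [(1 + X) ^ 2 = (1 + X ^ 2) + 2 X], where [2 X] accounts for the mixed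
    pairs; expand the [L]-th power by the number [m] of these. *)
Lemma bin_mixed_coef (L r k : nat) :
  'C(2 * L + r, k) = (\sum_(m < L.+1) 'C(L, m) * 2 ^ m * mixed_coef L r k m)%N.
Proof.
rewrite -[LHS]natn -coef_expr_1DX.
have -> : (1 + 'X : {poly nat}) ^+ (2 * L + r) =
    ((1 + 'X^2) + 'X *+ 2) ^+ L * (1 + 'X) ^+ r.
  rewrite exprD exprM; congr (_ ^+ _ * _).
  by rewrite sqrrD expr1n mul1r addrAC.
rewrite exprDn mulr_suml coef_sum; apply: eq_bigr => m _.
rewrite exprMn_n mulrnAr -mulrnA mulrnAl coefMn.
by rewrite /mixed_coef -[LHS]mulr_natr natn mulrC (mulnC 'C(L, m)).
Qed.

(* The outer variable ['X] is [Y], which counts false coins on the left pan plus good coins on the right pan; ['X%:P] is [X], which counts false coins. *)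
Lemma coef_balanced_gf (L r k : nat) :
  (((('X%:P + 'X) ^+ L * (1 + 'X%:P * 'X) ^+ L * ((1 + 'X) ^+ r)%:P)
     : {poly {poly nat}})`_L)`_k =
  (\sum_(m < L.+1) 'C(L, m) * central_bin m * mixed_coef L r k m)%N.
Proof.
rewrite -exprMn.
have -> : ('X%:P + 'X) * (1 + 'X%:P * 'X) =
    'X * (1 + 'X^2)%:P + 'X%:P * (1 + 'X^2) :> {poly {poly nat}}.
  rewrite rmorphD rmorphXn /=; ring.
rewrite exprDn mulr_suml !coef_sum; apply: eq_bigr => m _.
rewrite mulrnAl !coefMn !exprMn -!rmorphXn /=.
have -> : 'X^(L - m) * ((1 + 'X^2) ^+ (L - m))%:P * (('X^m)%:P * (1 + 'X^2) ^+ m) *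
    ((1 + 'X) ^+ r)%:P = 'X^(L - m) * ((1 + 'X^2) ^+ m *
    ((1 + 'X^2) ^+ (L - m) * 'X^m * (1 + 'X) ^+ r)%:P) :> {poly {poly nat}}.
  by rewrite !polyCM; ring.
have mL : (m <= L)%N by rewrite -ltnS.
rewrite coefXnM ltnNge leq_subr /= subKn // coefMC coef_expr_1DXn2.
by rewrite mulr_natl coefMn -mulrnA -[LHS]mulr_natr natn mulrC (mulnC 'C(L, m)).
Qed.

(* [(L + 1) / (m + 1) * 'C(L, m) = 'C(L + 1, m + 1)] turns the left-hand side into the expansion of the right-hand side over mixed pairs, without its term [m = 0]. *)
Lemma sum_mixed_coef_le (R : realFieldType) (L r k : nat) :
  2 * L.+1%:R * \sum_(m < L.+1) ('C(L, m) * 2 ^ m * mixed_coef L r k m)%:R / m.+1%:R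
  <= 'C((2 * L + r).+2, k.+1)%:R :> R.
Proof.
have -> : (2 * L + r).+2 = (2 * L.+1 + r)%N by lia.
rewrite bin_mixed_coef natr_sum [leRHS]big_ord_recl /= -[leLHS]add0r lerD ?ler0n //.
rewrite mulr_sumr; apply: ler_sum => m _.
have -> : bump 0 m = m.+1 by [].
rewrite mulrCA mulrA ler_pdivrMr ?ltr0Sn // -!natrM ler_nat.
have -> : mixed_coef L.+1 r k.+1 m.+1 = mixed_coef L r k m.
  by rewrite /mixed_coef subSS (exprSr _ m) mulrA mulrAC coefMX.
rewrite expnS; have := mul_bin_diag L.+1 m; rewrite /=.
move: ('C(L, m)) ('C(L.+1, m.+1)) (2 ^ m)%N (mixed_coef _ _ _ _) => a b c d h.
have -> : (a * c * d * (2 * L.+1) = L.+1 * a * (2 * c * d))%N by ring.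
by rewrite h; nia.
Qed.

(** * Cauchy-Schwarz over the number of mixed pairs *)

(** With [A], [B], [D] the sums of [u], [u b], [u b ^ 2], the nonnegative sum of [u (B - A b) ^ 2]
    equals [A (A D - B ^ 2)]. *)
Lemma sqr_weighted_sum_le (R : realFieldType) (I : finType) (u b : I -> R) :
  (forall i, 0 <= u i) -> 0 < \sum_i u i ->
  (\sum_i u i * b i) ^+ 2 <= (\sum_i u i) * \sum_i u i * b i ^+ 2.
Proof.
move=> u0; set A := \sum_i u i; set B := \sum_i u i * b i; set D := \sum_i _ => A0.
have : 0 <= \sum_i u i * (B - A * b i) ^+ 2.
  by apply: sumr_ge0 => i _; rewrite mulr_ge0 ?sqr_ge0.
have -> : \sum_i u i * (B - A * b i) ^+ 2 = A * (A * D - B ^+ 2).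
  transitivity (\sum_i (B ^+ 2 * u i - 2 * A * B * (u i * b i) + A ^+ 2 * (u i * b i ^+ 2))).
    by apply: eq_bigr => i _; ring.
  rewrite big_split sumrB /= -!mulr_sumr -/A -/B -/D; ring.
by rewrite pmulr_rge0 // subr_ge0.
Qed.

(** Weight [u m] counts the placements with [m] mixed pairs and [b m] is the return probability of
    the walk, so [b m ^ 2 <= 1 / (m + 1)]. The hypothesis on [k] makes the total weight positive. *)
Lemma sqr_central_mixed_coef_le (L r k : nat) : (k <= 2 * L + r)%N ->
  ((\sum_(m < L.+1) 'C(L, m) * central_bin m * mixed_coef L r k m) ^ 2
    * (2 * L.+1) <= 'C(2 * L + r, k) * 'C((2 * L + r).+2, k.+1))%N.
Proof.
move=> kN; rewrite -(ler_nat rat) natrM natrX (natrM _ 'C(_, _)).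
pose u (m : 'I_L.+1) : rat := ('C(L, m) * 2 ^ m * mixed_coef L r k m)%:R.
pose b (m : 'I_L.+1) : rat := (central_bin m)%:R / 2 ^+ m.
have Au : ('C(2 * L + r, k))%:R = \sum_m u m by rewrite bin_mixed_coef natr_sum.
have -> : (\sum_(m < L.+1) 'C(L, m) * central_bin m * mixed_coef L r k m)%:R
    = \sum_m u m * b m.
  rewrite natr_sum; apply: eq_bigr => m _; rewrite /u /b !natrM natrX.
  by field; rewrite expf_neq0.
have u0 m : 0 <= u m by rewrite ler0n.
have A0 : 0 < \sum_m u m by rewrite -Au ltr0n bin_gt0.
have le2 : \sum_m u m * b m ^+ 2 <= \sum_m u m / m.+1%:R.
  apply: ler_sum => m _; rewrite ler_wpM2l // /b expr_div_n ler_pdivrMr ?exprn_gt0 //.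
  rewrite mulrC ler_pdivlMr ?ltr0Sn // -!natrX -natrM ler_nat.
  by rewrite -expnM (mulnC m) (expnM 2 2) central_bin_sqr_le.
have le3 := sum_mixed_coef_le rat L r k.
rewrite Au.
apply: le_trans (ler_wpM2l (ltW A0) le3); rewrite natrM mulrC [leRHS]mulrCA.
rewrite ler_wpM2l ?mulr_ge0 ?ler0n //.
have le1 := @sqr_weighted_sum_le _ _ u b u0 A0.
apply: le_trans le1 _.
by rewrite ler_wpM2l // ltW.
Qed.

(** * Counting the strings of weight [k] that balance a query *)

Lemma card_option_fiber (N : nat) (q : qstring N) : nleft q = nright q ->
  #|[set i | q i == None]| = (N - 2 * nleft q)%N /\ nweighed q = (2 * nleft q)%N.
Proof.
move=> hq.
have hw : nweighed q = (2 * nleft q)%N.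
  rewrite mul2n -addnn {2}hq /nweighed /nleft /nright -!sum1dep_card.
  rewrite (bigID (fun i => q i == Some true)) /=; congr addn.
    by apply: eq_bigl => i; case: (q i) => [[]|].
  by apply: eq_bigl => i; case: (q i) => [[]|].
split=> //; have := cardsC [set i | q i != None]; rewrite card_ord -/(nweighed q) hw.
have -> : ~: [set i | q i != None] = [set i | q i == None].
  by apply/setP => i; rewrite !inE negbK.
by move=> h; rewrite -[RHS](congr1 (subn^~ _) h) addKn.
Qed.

Lemma prod_option_fiber (S : comPzSemiRingType) (N : nat) (q : qstring N)
    (g : option bool -> S) :
  \prod_i g (q i) = g (Some false) ^+ nright q * g (Some true) ^+ nleft q *
    g None ^+ #|[set i | q i == None]|.
Proof.
have pE o : g o ^+ #|[set i | q i == o]| = \prod_i (if q i == o then g o else 1).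
  by rewrite -prodr_const -big_mkcond; apply: eq_bigl => i; rewrite inE.
rewrite /nleft /nright !pE -!big_split; apply: eq_bigr => i _ /=.
by case: (q i) => [[]|] /=; rewrite ?mul1r ?mulr1.
Qed.

(** Adding 1 for each right-pan coin turns the signed tilt into a natural number, usable as an
    exponent; balance then means the value [nright q]. *)
Definition shifted_tilt (o : option bool) (b : bool) : nat :=
  match o with Some true => b | Some false => ~~ b | None => 0 end.

Lemma balancedE (N : nat) (q : qstring N) (x : coins N) : nleft q = nright q ->
  ~~ chi x q = (nleft q == \sum_i shifted_tilt (q i) (x i)).
Proof.
move=> hq; rewrite /chi negbK hq.
have : (\sum_i shifted_tilt (q i) (x i))%:Z
    = \sum_i qentry (q i) * (x i)%:Z + (nright q)%:Z.
  rewrite /nright -sum1dep_card -!natz !natr_sum [X in _ + X]big_mkcond -big_split.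
  by apply: eq_bigr => i _; case: (q i) (x i) => [[]|] [].
move=> h; rewrite -eqz_nat h -{1}[Posz (nright q)]add0r (inj_eq (addIr _)).
by rewrite eq_sym.
Qed.

(** Expanding the product over coins of the two-term sums [F (q i) false + F (q i) true] gives one
    monomial per [x]: its inner exponent is [wt x], its outer one the shifted tilt. Grouping the
    factors by pan gives the polynomial of [coef_balanced_gf]. *)
Lemma card_balanced (N k : nat) (q : qstring N) : nleft q = nright q ->
  let L := nleft q in
  #|[set x : coins N | (wt x == k) && ~~ chi x q]| =
  (\sum_(m < L.+1) 'C(L, m) * central_bin m * mixed_coef L (N - 2 * L) k m)%N.
Proof.
move=> hq /=; have [hN _] := card_option_fiber hq.
pose F o b : {poly {poly nat}} := ('X^(nat_of_bool b))%:P * 'X^(shifted_tilt o b).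
have <- : ((\prod_i \sum_b F (q i) b)`_(nleft q))`_k =
 (\sum_(m < (nleft q).+1) 'C(nleft q, m) * central_bin m * mixed_coef (nleft q) (N - 2 * nleft q) k m)%N.
  rewrite -coef_balanced_gf; congr ((_ : {poly {poly nat}})`_ _)`_ _.
  rewrite (prod_option_fiber q (fun o => \sum_b F o b)) hN -hq.
  rewrite !big_bool /F /= !expr0 !expr1 !mulr1 !mul1r rmorphXn /=.
  by rewrite polyCD polyC1 [1 + _ * _]addrC [1 + _]addrC.
rewrite (bigA_distr_bigA (fun i b => F (q i) b)) /= !coef_sum.
rewrite -sum1dep_card big_mkcond; apply: eq_bigr => x _.
rewrite /F big_split -rmorph_prod /= !prodrXr coefCM coefXn -balancedE //.
have -> : (\sum_i x i)%N = wt x.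
  by rewrite /wt -sum1dep_card [RHS]big_mkcond.
case: chi; rewrite ?andbF ?mulr0 ?coef0 // andbT mulr1 coefXn eq_sym.
by case: eqP.
Qed.

Lemma card_wt (N k : nat) : #|[set x : coins N | wt x == k]| = 'C(N, k).
Proof.
pose f (x : coins N) := [set i | x i].
have bf : bijective f.
  exists (fun A : {set 'I_N} => [ffun i => i \in A]) => x.
    by apply/ffunP => i; rewrite ffunE inE.
  by apply/setP => i; rewrite inE ffunE.
rewrite -[N in RHS]card_ord -card_draws -(@on_card_preimset _ _ f).
  by apply: eq_card => x; rewrite !inE.
exact: onW_bij.
Qed.

Lemma card_balanced_sqr_le (N l k : nat) (q : qstring N) :
  (k.*2 < N)%N -> admissible l q ->
  (#|[set x : coins N | (wt x == k) && ~~ chi x q]| ^ 2 * (l * k) <=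
   4 * N * 'C(N, k) ^ 2)%N.
Proof.
move=> kN /andP[/eqP hq hl]; have [_ hw] := card_option_fiber hq.
have LN : (2 * nleft q <= N)%N by rewrite -hw -[leqRHS]card_ord max_card.
rewrite card_balanced //.
have := @sqr_central_mixed_coef_le (nleft q) (N - 2 * nleft q) k.
rewrite subnKC //; move: (\sum_(m < _) _)%N => B /(_ ltac:(lia)) h.
have h1 := mul_bin_diag N.+2 k; have h2 := mul_bin_down N.+1 k.
rewrite /= in h1 h2; rewrite {}hw in hl.
move: (nleft q) ('C(N, k)) 'C(N.+2, k.+1) 'C(N.+1, k) hl h h1 h2 {hq LN} => L A C D hl h h1 h2.
have h3 : (k.+1 * (N.+1 - k) * C = N.+2 * N.+1 * A)%N.
  by rewrite mulnAC -h1 -!mulnA (mulnC D) -h2.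
have h4 : (B ^ 2 * (l * k) <= A * C * k.+1)%N.
  apply: (@leq_trans (B ^ 2 * (2 * L.+1) * k.+1)); last by rewrite leq_mul.
  by rewrite -!mulnA leq_mul2l; apply/orP; right; clear -hl; nia.
(* Here [2 k < N] enters, through [N + 2 <= 2 (N + 1 - k)]. *)
have h5 : (A * C * k.+1 * N.+2 <= 2 * N.+1 * A ^ 2 * N.+2)%N.
  have -> : (2 * N.+1 * A ^ 2 * N.+2 = 2 * A * (N.+2 * N.+1 * A))%N by ring.
  rewrite -h3 (_ : 2 * A * _ = A * C * k.+1 * (2 * (N.+1 - k)))%N; last by ring.
  by rewrite leq_mul //; lia.
rewrite leq_pmul2r // in h5; apply: leq_trans h4 (leq_trans h5 _).
by rewrite leq_mul //; lia.
Qed.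

Lemma leq_bin (n k : nat) : (0 < k < n)%N -> (n <= 'C(n, k))%N.
Proof.
elim: n k => [|n IHn] [|k] // /andP[_ kn]; rewrite binS.
have [<-|ne] := eqVneq k.+1 n; first by rewrite binn binSn.
by rewrite -addn1 leq_add ?bin_gt0 ?IHn //; lia.
Qed.

(** * Squared norms of amplitudes and states *)

Lemma sqnorm_ge0 (R : realType) (z : R[i]) : 0 <= sqnorm z.
Proof. by case: z => a b /=; rewrite addr_ge0 ?sqr_ge0. Qed.

Lemma sqnormC (R : realType) (z : R[i]) : (sqnorm z)%:C%C = z^* * z.
Proof.
case: z => a b; rewrite /Num.conj /=; simpc; congr Complex; ring.
Qed.

(** In each real coordinate the gap is the square [s (u - v / s) ^ 2]. The parameter [s] is tuned at
    each use. *)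
Lemma sqnormD_le (R : realType) (s : R) (z w : R[i]) : 0 < s ->
  sqnorm (z + w) <= (1 + s) * sqnorm z + (1 + s^-1) * sqnorm w.
Proof.
case: z w => [a b] [c d] s0 /=.
have key (u v : R) : (u + v) ^+ 2 <= (1 + s) * u ^+ 2 + (1 + s^-1) * v ^+ 2.
  rewrite -subr_ge0.
  have -> : (1 + s) * u ^+ 2 + (1 + s^-1) * v ^+ 2 - (u + v) ^+ 2
     = s * (u - s^-1 * v) ^+ 2 by field; rewrite gt_eqF.
  by rewrite mulr_ge0 ?sqr_ge0 ?ltW.
have := key a c; have := key b d; lra.
Qed.

Lemma sqnorm_sub_le (R : realType) (z w : R[i]) :
  sqnorm (z - w) <= 2 * sqnorm z + 2 * sqnorm w.
Proof.
case: z w => [a b] [c d] /=.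
have := sqr_ge0 (a + c); have := sqr_ge0 (b + d); nra.
Qed.

Definition norm2 (R : realType) (I : finType) (v : state R I) : R :=
  \sum_i sqnorm (v i).

Lemma norm2_apply (R : realType) (I : finType) (U : op R I) (v : state R I) :
  unitary U -> norm2 (apply U v) = norm2 v.
Proof.
move=> hU; apply: (@complexI R); rewrite /norm2 !rmorph_sum /=.
under eq_bigr => i _.
  rewrite sqnormC /apply rmorph_sum /= big_distrlr /=.
  under eq_bigr => j _ do under eq_bigr => l _ do rewrite rmorphM mulrACA.
  over.
rewrite exchange_big /=; apply: eq_bigr => j _.
rewrite exchange_big /=. rewrite (bigD1 j) //= [X in _ + X]big1 ?addr0.
  by rewrite -mulr_suml hU eqxx mul1r sqnormC.
by move=> l ne; rewrite -mulr_suml hU eq_sym (negPf ne) mul0r.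
Qed.

Lemma applyB (R : realType) (I : finType) (U : op R I) (v w : state R I) (i : I) :
  apply U (fun j => v j - w j) i = apply U v i - apply U w i.
Proof.
by rewrite /apply -sumrB; apply: eq_bigr => j _; rewrite mulrBr. Qed.

Lemma norm2_eq (R : realType) (I : finType) (v w : state R I) :
  v =1 w -> norm2 v = norm2 w.
Proof. by move=> vw; apply: eq_bigr => i _; rewrite vw. Qed.

Lemma norm2D_le (R : realType) (I : finType) (s : R) (v w : state R I) : 0 < s ->
  norm2 (fun i => v i + w i) <= (1 + s) * norm2 v + (1 + s^-1) * norm2 w.
Proof.
move=> s0; rewrite /norm2 !mulr_sumr -big_split /=.
by apply: ler_sum => i _; apply: sqnormD_le.
Qed.

(** * Hybrid argument comparing the true run with the always-tilted run *)

Section Oracles.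
Variables (R : realType) (N l : nat) (W : finType).
Implicit Types (v w : state R (basis N l W)) (A : algorithm R N l W).

Definition tilted_oracle v : state R (basis N l W) :=
  fun b => let: (q, a, w) := b in v (q, ~~ a, w).

Fixpoint tilted_run A (t : nat) : state R (basis N l W) :=
  match t with
  | 0 => apply (alg_U A 0) (fun b => (b == alg_init A)%:R)
  | t'.+1 => apply (alg_U A t) (tilted_oracle (tilted_run A t'))
  end.

Lemma norm2_oracle (x : coins N) v : norm2 (oracle x v) = norm2 v.
Proof.
pose f (b : basis N l W) : basis N l W :=
  let: (q, a, w) := b in (q, xorb a (chi x (val q)), w).
have fK : involutive f by case=> [[q a] w] /=; case: a (chi _ _) => [] [].
rewrite /norm2 [RHS](reindex_inj (inv_inj fK)) /=.
by apply: eq_bigr => -[[q a] w] _.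
Qed.

Lemma norm2_tilted_oracle v : norm2 (tilted_oracle v) = norm2 v.
Proof.
pose f (b : basis N l W) : basis N l W := let: (q, a, w) := b in (q, ~~ a, w).
have fK : involutive f by case=> [[q a] w] /=; rewrite negbK.
rewrite /norm2 [RHS](reindex_inj (inv_inj fK)) /=.
by apply: eq_bigr => -[[q a] w] _.
Qed.

Lemma norm2_tilted_run A (T t : nat) :
  (forall t, (t <= T)%N -> unitary (alg_U A t)) -> (t <= T)%N ->
  norm2 (tilted_run A t) = 1.
Proof.
move=> hU; elim: t => [|t IHt] tT /=.
  rewrite norm2_apply; last exact: hU.
  rewrite /norm2 (bigD1 (alg_init A)) //= eqxx big1 ?addr0 /= ?expr1n ?expr0n ?addr0 //.
  by move=> b /negPf ->; rewrite /= expr0n /= addr0.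
by rewrite norm2_apply ?norm2_tilted_oracle ?IHt //; [apply: ltnW|apply: hU].
Qed.

Definition balanced_mass (x : coins N) v : R :=
  \sum_(b | ~~ chi x (val b.1.1)) sqnorm (v b).

(** The oracles differ only on balanced queries, by the two amplitudes with opposite answer bits;
    each amplitude is counted twice with coefficient 2. *)
Lemma norm2_oracle_diff_le (x : coins N) v :
  norm2 (fun b => oracle x v b - tilted_oracle v b) <= 4 * balanced_mass x v.
Proof.
pose f (b : basis N l W) : basis N l W := let: (q, a, w) := b in (q, ~~ a, w).
have fK : involutive f by case=> [[q a] w] /=; rewrite negbK.
have -> : 4 * balanced_mass x v =
   \sum_(b : basis N l W | ~~ chi x (val b.1.1)) (2 * sqnorm (v b) + 2 * sqnorm (v (f b))).
  rewrite big_split -!mulr_sumr /=.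
  rewrite (_ : \sum_(b : basis N l W | _) sqnorm (v (f b)) = balanced_mass x v).
    by rewrite /balanced_mass; ring.
  rewrite /balanced_mass [RHS](reindex_inj (inv_inj fK)) /=.
  by apply: eq_bigl => -[[q a] w].
rewrite [leRHS]big_mkcond; apply: ler_sum => -[[q a] w] _ /=.
by case: chi; case: a => /=; rewrite ?sqnorm_sub_le // subrr /= expr0n /= addr0.
Qed.

(** One more query carries the old error through the true oracle, which preserves its norm, and adds
    the disagreement of the oracles on the tilted state, which does not depend on [x]. *)
Lemma norm2_run_diff_le A (T : nat) (x : coins N) :
  (forall t, (t <= T)%N -> unitary (alg_U A t)) ->
  norm2 (fun b => run A x T b - tilted_run A T b) <=
  T%:R * \sum_(t < T) 4 * balanced_mass x (tilted_run A t).
Proof.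
elim: T => [|T IHT] hU.
  rewrite mul0r /norm2 big1 // => b _.
  by rewrite subrr /= expr0n /= addr0.
have {}IHT := IHT (fun t tT => hU t (leqW tT)).
set v := run A x T; set w := tilted_run A T.
have -> : norm2 (fun b => run A x T.+1 b - tilted_run A T.+1 b) =
    norm2 (fun b => oracle x (fun b => v b - w b) b
                 + (oracle x w b - tilted_oracle w b)).
  rewrite -[RHS](norm2_apply (U := alg_U A T.+1)); last exact: hU.
  apply: norm2_eq => b /=; rewrite -/v -/w -applyB.
  apply: eq_bigr => -[[q a] z] _; congr (_ * _).
  by rewrite addrA subrK.
have dle := norm2_oracle_diff_le x w.
set S := \sum_(t < T) _ in IHT.
have S0 : 0 <= S by apply: sumr_ge0 => t _; rewrite mulr_ge0 ?sumr_ge0 // => b _; apply: sqnorm_ge0.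
rewrite big_ord_recr /= -/S -/w.
have [T0|T0] := posnP T.
  rewrite (@norm2_eq _ _ _ (fun b => oracle x w b - tilted_oracle w b)).
    by apply: le_trans dle _; rewrite T0 mul1r lerDr.
  by case=> [[q a] z] /=; rewrite /v /w T0 subrr add0r.
have T0' : 0 < T%:R :> R by rewrite ltr0n.
(* With [s = 1 / T], both [(1 + s) T] and [1 + 1 / s] equal [T + 1], which closes the induction. The
   case [T = 0] was split off because [s] must be positive. *)
apply: (le_trans (norm2D_le (s := T%:R^-1) _ _ _)); first by rewrite invr_gt0.
rewrite invrK norm2_oracle.
set a := norm2 _ in IHT *; set d := norm2 _ in dle *; set e := 4 * _ in dle *.
have -> : T.+1%:R * (S + e) = (1 + T%:R^-1) * (T%:R * S) + (1 + T%:R) * e :> R.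
  by rewrite -natr1; field; rewrite gt_eqF.
by rewrite lerD // ler_wpM2l // addr_ge0 ?invr_ge0 ?ler0n.
Qed.

End Oracles.

(** * Averaging over the hidden string and the query bound *)

(** After exchanging sums, each basis state is weighted by the number of [x] that balance its
    query. *)
Lemma sum_balanced_mass_le (R : realType) (N l k : nat) (W : finType) (D : R)
    (v : state R (basis N l W)) :
  (forall q : qstring N, admissible l q ->
     #|[set x : coins N | (wt x == k) && ~~ chi x q]|%:R <= D) ->
  \sum_(x : coins N | wt x == k) balanced_mass x v <= D * norm2 v.
Proof.
move=> hD; rewrite /balanced_mass.
under eq_bigr => x _ do rewrite big_mkcond.
rewrite exchange_big /norm2 mulr_sumr /=; apply: ler_sum => -[[q a] w] _ /=.
rewrite -big_mkcondr /= sumr_const -[_ *+ _]mulr_natl.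
rewrite ler_wpM2r ?sqnorm_ge0 //; apply: le_trans (hD _ (valP q)).
by rewrite cardsE.
Qed.

Lemma success_prob_le (R : realType) (N l T : nat) (W : finType)
    (A : algorithm R N l W) (x : coins N) :
  success_prob A T x <=
  3 / 2 * \sum_(b | alg_out A b == x) sqnorm (tilted_run A T b) +
  3 * norm2 (fun b => run A x T b - tilted_run A T b).
Proof.
apply: (@le_trans _ _ (\sum_(b | alg_out A b == x)
   (3 / 2 * sqnorm (tilted_run A T b)
    + 3 * sqnorm (run A x T b - tilted_run A T b)))).
  apply: ler_sum => b _; rewrite -{1}[run A x T b](subrKC (tilted_run A T b)).
  (* The choice [s = 1 / 2] gives the coefficients [3 / 2] and [3]. *)
  have := sqnormD_le (tilted_run A T b) (run A x T b - tilted_run A T b) (s := 2^-1).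
  rewrite invr_gt0 ltr0Sn invrK => /(_ isT) h; lra.
rewrite big_split -!mulr_sumr lerD2l ler_wpM2l // /norm2.
rewrite (big_mkcond (fun i => alg_out A i == x)); apply: ler_sum => b _.
by case: ifP => // _; apply: sqnorm_ge0.
Qed.

(* Averages [success_prob_le] over all [x] of weight [k], the tilted run being common to all of them. *)
Lemma identifies_query_bound (R : realType) (N l k T : nat) (W : finType)
    (A : algorithm R N l W) (p D : R) :
  identifies k T A p ->
  (forall q : qstring N, admissible l q ->
     #|[set x : coins N | (wt x == k) && ~~ chi x q]|%:R <= D) ->
  p * 'C(N, k)%:R <= 3 / 2 + 12 * T%:R ^+ 2 * D.
Proof.
move=> [hU hp] hD.
have -> : p * 'C(N, k)%:R = \sum_(x : coins N | wt x == k) p.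
  by rewrite sumr_const -card_wt cardsE mulr_natr.
apply: (@le_trans _ _ (\sum_(x : coins N | wt x == k)
  (3 / 2 * \sum_(b | alg_out A b == x) sqnorm (tilted_run A T b) +
   3 * (T%:R * \sum_(t < T) 4 * balanced_mass x (tilted_run A t))))).
  apply: ler_sum => x /eqP wx; apply: le_trans (hp x wx) _.
  apply: le_trans (success_prob_le _ _ _) _.
  by rewrite lerD2l ler_wpM2l // norm2_run_diff_le.
rewrite big_split /= -!mulr_sumr; apply: lerD.
  (* The outputs partition the basis, so the success probabilities of the common tilted run sum to
     at most 1. *)
  rewrite -[leRHS]mulr1 ler_wpM2l ?divr_ge0 //.
  rewrite -[leRHS](norm2_tilted_run hU (leqnn T)) /norm2 (partition_big (alg_out A) xpredT) //=.
  rewrite [leLHS]big_mkcond; apply: ler_sum => x _; case: ifP => // _.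
  by apply: sumr_ge0 => b _; apply: sqnorm_ge0.
rewrite exchange_big /=.
have : \sum_(t < T) \sum_(x : coins N | wt x == k) 4 * balanced_mass x (tilted_run A t)
    <= \sum_(t < T) 4 * D.
  apply: ler_sum => t _; rewrite -mulr_sumr ler_wpM2l //.
  by rewrite -[D]mulr1 -(norm2_tilted_run hU (ltnW (ltn_ord t))) sum_balanced_mass_le.
rewrite sumr_const card_ord -[_ *+ T]mulr_natl => h.
have -> : 12 * T%:R ^+ 2 * D = 3 * (T%:R * (T%:R * (4 * D))) by ring.
by rewrite ler_wpM2l // ler_wpM2l.
Qed.

Lemma query_lower_bound (R : realType) (p : R) : 1 / 2 < p ->
  forall (N k l T : nat) (W : finType) (A : algorithm R N l W),
    (1 <= k)%N -> (k.*2 < N)%N -> (1 <= l)%N -> identifies k T A p ->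
    ((p - 1 / 2) / 24) ^+ 2 * (l * k)%:R <= (T ^ 4 * N)%:R.
Proof.
move=> hp N k l T W A k0 kN l0 hA.
set C := 'C(N, k).
(* From [1 <= k < N / 2] follows [N >= 3]. Thus the guessing term [3 / 2] is at most [C / 2], and
   the gap [p - 1 / 2] remains for the query term. *)
have C3 : (3 <= C)%N by apply: leq_trans (leq_bin _); lia.
have C3R : 3 <= C%:R :> R by rewrite (ler_nat _ 3).
have lk0 : 0 < (l * k)%:R :> R by rewrite ltr0n muln_gt0 l0.
pose D : R := Num.sqrt ((4 * N * C ^ 2)%:R / (l * k)%:R).
have hD q : admissible l q ->
    #|[set x : coins N | (wt x == k) && ~~ chi x q]|%:R <= D.
  move=> hq; rewrite -[leLHS]ger0_norm ?ler0n // -sqrtr_sqr; apply: ler_wsqrtr.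
  by rewrite ler_pdivlMr // -natrX -natrM ler_nat card_balanced_sqr_le.
have D2 : D ^+ 2 * (l * k)%:R = 4 * N%:R * C%:R ^+ 2.
  rewrite sqr_sqrtr ?divr_ge0 ?ler0n // divfK ?gt_eqF //.
  by rewrite natrM natrX natrM.
have bound := identifies_query_bound hA hD.
have D0 : 0 <= D by apply: sqrtr_ge0.
have h : (p - 1 / 2) / 24 * (2 * C%:R) <= T%:R ^+ 2 * D.
  have : 3 / 2 <= 1 / 2 * C%:R :> R by lra.
  rewrite -/C in bound; nra.
have h2 : ((p - 1 / 2) / 24 * (2 * C%:R)) ^+ 2 <= (T%:R ^+ 2 * D) ^+ 2.
  rewrite ler_sqr // nnegrE ?mulr_ge0 ?sqr_ge0 //; lra.
have C20 : 0 < 4 * C%:R ^+ 2 :> R by rewrite mulr_gt0 // exprn_gt0 // ltr0n; lia.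
rewrite -(ler_pM2r C20) (natrM _ (T ^ 4)) natrX.
have -> : T%:R ^+ 4 * N%:R * (4 * C%:R ^+ 2) = (T%:R ^+ 2 * D) ^+ 2 * (l * k)%:R.
  by transitivity (T%:R ^+ 4 * (D ^+ 2 * (l * k)%:R)); [rewrite D2|]; ring.
apply: le_trans (ler_wpM2r (ltW lk0) h2).
by rewrite le_eqVlt; apply/orP; left; apply/eqP; ring.
Qed.
(* Omega((l k / N)^(1/4)) is written without roots: T >= c' (lk/N)^(1/4) with
   c' > 0 iff c * (l*k) <= T^4 * N with c = c'^4 > 0. *)
Theorem theorem2 (R : realType) (p : R) (hp : 1 / 2 < p) :
  (exists2 c : R, 0 < c &
    forall (N k l T : nat) (W : finType) (A : algorithm R N l W),
      (1 <= k)%N -> (k.*2 < N)%N -> (1 <= l)%N ->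
      identifies k T A p ->
      c * ((l * k)%:R) <= (T ^ 4 * N)%:R) /\
  (forall c0 : R, 0 < c0 ->
    exists2 c : R, 0 < c &
    forall (N k l T : nat) (W : finType) (A : algorithm R N l W),
      (1 <= k)%N -> (k.*2 < N)%N -> (1 <= l)%N ->
      N%:R <= c0 * l%:R ->
      identifies k T A p ->
      c * k%:R <= (T ^ 4)%:R).
Proof.
set c := ((p - 1 / 2) / 24) ^+ 2.
have c0 : 0 < c by rewrite exprn_gt0 // divr_gt0 // subr_gt0.
split=> [|a a0]; first by exists c => // N k l T W A; apply: query_lower_bound.
(* From [c l k <= T ^ 4 N <= T ^ 4 a l], cancel [l]. *)
exists (c / a) => [|N k l T W A k0 kN l0 Nl hA]; first by rewrite divr_gt0.
have h := query_lower_bound hp k0 kN l0 hA.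
have lR : 0 < l%:R :> R by rewrite ltr0n.
rewrite mulrAC ler_pdivrMr // -(ler_pM2r lR) -[leLHS]mulrA -[leRHS]mulrA -natrM (mulnC k).
by apply: le_trans h _; rewrite natrM ler_wpM2l ?ler0n.
Qed.
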